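(* For any positive integers $n$, $p$, and $q$: (a) $\left\lfloor \frac{n^2}{8} \right\rfloor \le \sigma^1_3(K_n) \le \frac{n^2+5n+6}{6}$; and (b) $\left\lceil \frac{pq}{4} \right\rceil \le \sigma^1_3(K_{p,q}) \le \left\lceil \frac{p}{2} \right\rceil \left\lceil \frac{q}{2} \right\rceil$.
   Context: Graphs are finite and simple. $K_n$ is the complete graph on $n$ vertices and $K_{p,q}$ the complete bipartite graph with parts of sizes $p$ and $q$. A circular-arc drawing of a graph $G$ in $\mathbb{R}^d$ represents the vertices by distinct points and each edge by a circular arc (a proper sub-arc of a circle) connecting the points of its endvertices; it is crossing-free if no edge passes through a vertex other than its endpoints and any two edges are disjoint except possibly at common endpoints. For integers $1\le l<d$, the spherical cover number $\sigma^l_d(G)$ is the minimum number of $l$-dimensional spheres in $\mathbb{R}^d$ (a $1$-dimensional sphere is a circle) such that $G$ has a crossing-free circular-arc drawing in $\mathbb{R}^d$ that is contained in the union of these spheres. *)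

(* Defs.v *)
From HB Require Import structures.
From mathcomp Require Import all_boot all_order all_algebra.
From mathcomp Require Import all_classical all_reals all_analysis.

Set Implicit Arguments.
Unset Strict Implicit.
Unset Printing Implicit Defensive.

Import Order.TTheory GRing.Theory Num.Theory.
Local Open Scope classical_set_scope.
Local Open Scope ring_scope.

Record sgraph := SGraph {
  svertex :> finType;
  sedge : rel svertex;
  sedge_sym : symmetric sedge;
  sedge_irr : irreflexive sedge }.

Definition edges (G : sgraph) : {set {set G}} :=
  [set A : {set G} | [exists x, exists y, sedge x y && (A == [set x; y]%SET)]].

Lemma Kn_sym n : symmetric (fun x y : 'I_n => x != y).
Proof. by move=> x y; rewrite eq_sym. Qed.

Lemma Kn_irr n : irreflexive (fun x y : 'I_n => x != y).
Proof. by move=> x; rewrite eqxx. Qed.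

Definition complete_graph (n : nat) : sgraph := SGraph (@Kn_sym n) (@Kn_irr n).

Definition Kpq_edge (p q : nat) : rel ('I_p + 'I_q)%type :=
  fun x y => match x, y with
             | inl _, inr _ | inr _, inl _ => true
             | _, _ => false
             end.

Lemma Kpq_sym p q : symmetric (@Kpq_edge p q).
Proof. by move=> [x|x] [y|y]. Qed.

Lemma Kpq_irr p q : irreflexive (@Kpq_edge p q).
Proof. by move=> [x|x]. Qed.

Definition complete_bipartite_graph (p q : nat) : sgraph :=
  SGraph (@Kpq_sym p q) (@Kpq_irr p q).

(* The Euclidean structure on ['rV[R]_d]; the library norm [`|x|] on row
   vectors is the sup norm, hence is not used here. *)
Definition dotp (R : realType) (d : nat) (x y : 'rV[R]_d) : R :=
  \sum_(i < d) x 0 i * y 0 i.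

(* An l-sphere is the Euclidean sphere of radius r about c inside the
   (l+1)-dimensional affine subspace c + rowspace(W). *)
Definition is_sphere (R : realType) (d l : nat) (S : set 'rV[R]_d) : Prop :=
  exists (c : 'rV[R]_d) (r : R) (W : 'M[R]_(l.+1, d)),
    [/\ 0 < r, row_free W &
        S = [set x | (x - c <= W)%MS /\ dotp (x - c) (x - c) = r ^+ 2]].

Definition circle_point (R : realType) (d : nat) (c : 'rV[R]_d) (r : R)
    (u v : 'rV[R]_d) (t : R) : 'rV[R]_d :=
  c + r *: (cos t *: u + sin t *: v).

(* [S] is a closed proper sub-arc, with endpoints P and Q, of the circle of
   centre c and radius r in the plane c + <u, v>, (u, v) orthonormal. *)
Definition is_circular_arc (R : realType) (d : nat)
    (S : set 'rV[R]_d) (P Q : 'rV[R]_d) : Prop :=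
  exists (c : 'rV[R]_d) (r : R) (u v : 'rV[R]_d) (a b : R),
    [/\ 0 < r,
        [/\ dotp u u = 1, dotp v v = 1 & dotp u v = 0],
        a < b < a + 2 * pi,
        S = circle_point c r u v @` [set t | a <= t <= b] &
        circle_point c r u v a = P /\ circle_point c r u v b = Q].

Section Drawing.
Variables (R : realType) (d : nat) (G : sgraph).

(* [pos] places the vertices; [arc A] is the curve representing the edge [A],
   and its value is irrelevant when [A] is not an edge. *)
Definition is_circular_arc_drawing
    (pos : G -> 'rV[R]_d) (arc : {set G} -> set 'rV[R]_d) : Prop :=
  injective pos /\
  forall x y : G, sedge x y ->
    is_circular_arc (arc [set x; y]%SET) (pos x) (pos y).

Definition crossing_free
    (pos : G -> 'rV[R]_d) (arc : {set G} -> set 'rV[R]_d) : Prop :=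
  (forall (A : {set G}) (x : G),
     A \in edges G -> arc A (pos x) -> x \in A) /\
  (forall (A B : {set G}) (z : 'rV[R]_d),
     A \in edges G -> B \in edges G -> A != B -> arc A z -> arc B z ->
     exists2 x : G, x \in A :&: B & z = pos x).

Definition drawing_set
    (pos : G -> 'rV[R]_d) (arc : {set G} -> set 'rV[R]_d) : set 'rV[R]_d :=
  range pos `|` \bigcup_(A in [set A | A \in edges G]) arc A.

(* The spheres may repeat, so this says "at most s spheres suffice"; the least
   such s is the same as for families of distinct spheres. *)
Definition drawable_on_spheres (l s : nat) : Prop :=
  exists (pos : G -> 'rV[R]_d) (arc : {set G} -> set 'rV[R]_d)
         (S : 'I_s -> set 'rV[R]_d),
    [/\ is_circular_arc_drawing pos arc,
        crossing_free pos arc,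
        forall i, is_sphere l (S i) &
        drawing_set pos arc `<=` \bigcup_i S i].

End Drawing.

(* "s is the minimum": this includes that the minimum is attained. *)
Definition is_spherical_cover_number (R : realType) (l d : nat) (G : sgraph)
    (s : nat) : Prop :=
  drawable_on_spheres R d G l s /\
  forall s' : nat, drawable_on_spheres R d G l s' -> (s <= s')%N.

(* Main.v *)
Require Import Defs.
From mathcomp Require Import all_boot all_order all_algebra.
From mathcomp Require Import all_classical all_reals all_analysis.
From mathcomp Require Import ring lra zify.

Import Order.TTheory GRing.Theory Num.Theory numFieldNormedType.Exports.
Local Open Scope ring_scope.

(* Lower bounds: sweep a plane in a generic direction, avoiding the vertices
   and the centres of the circles. It meets each circle in at most two points,
   and each edge between the two sides in a point of its own, so s circles allow
   at most 2s such edges. A halving plane of K_n cuts floor(n^2/4) edges; in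
   K_{p,q} some plane cuts at least pq/2.

   Upper bounds: under stereographic projection of S^3, two antipodal pairs of
   points span a great circle that visits them alternately, so it carries all
   four edges between the pairs. With pairs taken in general position, great
   circles meet only in vertices. In R^3, the great circle spanned by (y, wy)
   and (z, wz) in R^4 is {x = a y + b z : |x|^2 - 1 = a wy + b wz}; general
   position comes from (y, w) = ((1, t, t^2), t^3) and a Vandermonde argument.
   The edge of K_n joining an antipodal pair is a half great circle through an
   auxiliary direction. This uses ceil(p/2) ceil(q/2) circles for K_{p,q}, and
   m(m+1)/2 circles with m = ceil(n/2) for K_n. *)

(** * Inner product and plane sections of circles *)

Lemma dotpC {R : realType} {d} (x y : 'rV[R]_d) : dotp x y = dotp y x.
Proof. by apply: eq_bigr => i _; rewrite mulrC. Qed.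

Lemma dotpDl {R : realType} {d} (x y z : 'rV[R]_d) :
  dotp (x + y) z = dotp x z + dotp y z.
Proof.
by rewrite /dotp -big_split; apply: eq_bigr => i _; rewrite mxE mulrDl.
Qed.

Lemma dotpZl {R : realType} {d} (a : R) (x y : 'rV[R]_d) :
  dotp (a *: x) y = a * dotp x y.
Proof. by rewrite /dotp mulr_sumr; apply: eq_bigr => i _; rewrite mxE mulrA. Qed.

Lemma dotpNl {R : realType} {d} (x y : 'rV[R]_d) : dotp (- x) y = - dotp x y.
Proof. by rewrite -scaleN1r dotpZl mulN1r. Qed.

Lemma dotpDr {R : realType} {d} (x y z : 'rV[R]_d) :
  dotp x (y + z) = dotp x y + dotp x z.
Proof. by rewrite dotpC dotpDl !(dotpC x). Qed.

Lemma dotpZr {R : realType} {d} (a : R) (x y : 'rV[R]_d) :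
  dotp x (a *: y) = a * dotp x y.
Proof. by rewrite dotpC dotpZl dotpC. Qed.

Lemma dotpNr {R : realType} {d} (x y : 'rV[R]_d) : dotp x (- y) = - dotp x y.
Proof. by rewrite dotpC dotpNl dotpC. Qed.

Definition dotpE := (@dotpDl, @dotpDr, @dotpNl, @dotpNr, @dotpZl, @dotpZr).

Lemma dotp_sqDZ {R : realType} {d} (x y : 'rV[R]_d) (a : R) :
  dotp (x + a *: y) (x + a *: y) =
  dotp x x + a * (2 * dotp x y + a * dotp y y).
Proof. by rewrite !dotpE (dotpC y); ring. Qed.

Lemma dotp_ge0 {R : realType} {d} (x : 'rV[R]_d) : 0 <= dotp x x.
Proof. by apply: sumr_ge0 => i _; rewrite -expr2 sqr_ge0. Qed.

Lemma dotp_eq0 {R : realType} {d} (x : 'rV[R]_d) : (dotp x x == 0) = (x == 0).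
Proof.
apply/eqP/eqP => [h|->]; last by rewrite -[0](scale0r 0) dotpZl mul0r.
apply/rowP => i; rewrite mxE; apply/eqP; rewrite -sqrf_eq0 expr2.
by apply/eqP; apply: (psumr_eq0P _ h) => // j _; rewrite -expr2 sqr_ge0.
Qed.

Lemma dotp_gt0 {R : realType} {d} (x : 'rV[R]_d) : (0 < dotp x x) = (x != 0).
Proof. by rewrite lt_def dotp_ge0 dotp_eq0 andbT. Qed.

Lemma exists_non_root {R : realType} (P : {poly R}) :
  P != 0 -> exists z, ~~ root P z.
Proof.
move=> P0; apply: contrapT => nr.
have: (size [seq k%:R : R | k <- iota 0 (size P)] < size P)%N.
  apply: max_poly_roots => //.
    by apply/allP => z _; apply: contrapT => /negP h; apply: nr; exists z.
  rewrite map_inj_uniq ?iota_uniq // => a b /eqP.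
  by rewrite eqr_nat => /eqP.
by rewrite size_map size_iota ltnn.
Qed.

(** The direction [w = (1, z, ..., z^(d-1))] pairs with [pos x - pos y] to the value at [z] of the
    polynomial with these coordinates as coefficients; [z] is chosen off the roots of these finitely
    many nonzero polynomials. *)
Lemma exists_injective_dotp {R : realType} {d} {T : finType}
    (pos : T -> 'rV[R]_d) :
  injective pos -> exists w, injective (fun x => dotp w (pos x)).
Proof.
move=> pos_inj.
pose P xy := rVpoly (pos xy.1 - pos xy.2).
have: \prod_(xy : T * T | xy.1 != xy.2) P xy != 0.
  apply/prodf_neq0 => -[x y] /=; apply: contra => /eqP h.
  rewrite -(inj_eq pos_inj) -subr_eq0 -[_ - _]rVpolyK [rVpoly _]h.
  by rewrite linear0.
move=> /exists_non_root[z]; rewrite /root horner_prod => /prodf_neq0 hz.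
exists (\row_i z ^+ i) => x y /eqP; apply: contraTeq => xy.
have /= := hz (x, y) xy; apply: contra => /eqP h.
rewrite horner_poly -[X in _ == X](subrr (dotp (\row_i z ^+ i) (pos x))) {2}h.
rewrite -dotpNr -dotpDr; apply/eqP/eq_bigr => i _.
by rewrite valK !mxE mulrC.
Qed.

(* Three points of a plane section of the circle would be collinear. *)
Lemma circle_section {R : realType} {d} (S : set 'rV[R]_d) : is_sphere 1 S ->
  exists c, forall w t, t != dotp w c -> forall z1 z2 z3, S z1 -> S z2 -> S z3 ->
    dotp w z1 = t -> dotp w z2 = t -> dotp w z3 = t ->
    [\/ z1 = z2, z1 = z3 | z2 = z3].
Proof.
move=> [c [r [W [r0 _ ->]]]]; exists c => w t tc z1 z2 z3.
set e1 := row 0 W; set e2 := row 1 W.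
have spanE z : (z - c <= W)%MS -> exists a b, z = c + (a *: e1 + b *: e2).
  move=> /submxP[u zE]; exists (u 0 0), (u 0 1).
  rewrite -[z in LHS](subrK c) zE addrC; congr (_ + _).
  rewrite mulmx_sum_row big_ord_recl big_ord1.
  by rewrite (_ : lift _ _ = 1) //; apply: val_inj.
move=> [/spanE[a1 [b1 ->]] r1] [/spanE[a2 [b2 ->]] r2] [/spanE[a3 [b3 ->]] r3].
move: r1 r2 r3; rewrite !(addrC c) !addrK => r1 r2 r3.
set y1 := a1 *: e1 + _ in r1 *.
(* [N] is orthogonal to [w], so the section of the circle lies on the line through the first point
   with direction [N]. *)
set N := dotp w e2 *: e1 - dotp w e1 *: e2.
have step a b : dotp (a *: e1 + b *: e2) (a *: e1 + b *: e2) = r ^+ 2 ->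
    dotp w (a *: e1 + b *: e2 + c) = t -> dotp w (y1 + c) = t ->
    exists k, a *: e1 + b *: e2 = y1 + k *: N /\
      k * (2 * dotp y1 N + k * dotp N N) = 0.
  move=> rab wab w1.
  have [k kE] : exists k, a *: e1 + b *: e2 = y1 + k *: N.
    move: wab w1; rewrite /y1 !dotpE => wab w1.
    have [f1|f1] := eqVneq (dotp w e1) 0.
      (* Were [w] orthogonal to both [e1] and [e2], the whole circle would lie at the level
         [dotp w c], which [t] avoids. *)
      have f2 : dotp w e2 != 0.
        by apply: contraNneq tc => f2; rewrite -w1 f1 f2 !mulr0 !add0r.
      exists ((a - a1) / dotp w e2).
      have -> : b = b1 by apply: (mulIf f2); move: wab w1; rewrite f1; lra.
      by apply/rowP => i; rewrite /y1 /N f1 !mxE; field.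
    exists (- (b - b1) / dotp w e1).
    have -> : a = a1 - (b - b1) / dotp w e1 * dotp w e2.
      apply: (mulIf f1); rewrite mulrBl mulrAC divfK //; lra.
    by apply/rowP => i; rewrite /y1 /N !mxE; field.
  exists k; split=> //; move: rab; rewrite kE -r1 dotp_sqDZ.
  by move=> ?; lra.
move=> w1 w2 w3.
have [k [-> k0]] := step _ _ r2 w2 w1.
have [l [-> l0]] := step _ _ r3 w3 w1.
have [->|kn0] := eqVneq k 0; first by constructor 1; rewrite scale0r addr0.
have [->|ln0] := eqVneq l 0; first by constructor 2; rewrite scale0r addr0.
have [N0|NN] := eqVneq N 0; first by constructor 1; rewrite N0 scaler0 addr0.
(* Both [k] and [l] are nonzero roots of a quadratic whose other root is 0. *)
constructor 3; suff -> : k = l by [].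
move: k0 l0 => /eqP; rewrite mulf_eq0 (negPf kn0) /= => /eqP k0.
move=> /eqP; rewrite mulf_eq0 (negPf ln0) /= => /eqP l0.
rewrite -dotp_eq0 in NN; apply: (mulIf NN); lra.
Qed.

(** * Counting the edges cut by a plane *)

Lemma card_le_fibers (T I : finType) (E : {set T}) (Rel : T -> I -> Prop) k :
  (forall x, x \in E -> exists i, Rel x i) ->
  (forall i, #|[set x in E | `[< Rel x i >]]| <= k)%N -> (#|E| <= k * #|I|)%N.
Proof.
move=> cov fib.
have sub : E \subset \bigcup_i [set x in E | `[< Rel x i >]].
  apply/fintype.subsetP => x xE; have [i ri] := cov x xE.
  by apply/bigcupP; exists i => //; rewrite inE xE; apply/asboolP.
apply: leq_trans (subset_leq_card sub) _.
have le_card : (#|\bigcup_i [set x in E | `[< Rel x i >]]| <=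
    \sum_i #|[set x in E | `[< Rel x i >]]|)%N.
  elim/big_ind2: _ => [|A a B b hA hB|//]; first by rewrite cards0.
  by rewrite (leq_trans (leq_card_setU _ _)) // leq_add.
apply: leq_trans le_card _; rewrite mulnC -sum_nat_const.
by apply: leq_sum => i _.
Qed.

(** Supplies the level of the sweeping plane: [y] will be the height of the highest vertex below it,
    and [s] the heights of all vertices and centres. *)
Lemma exists_gap {R : realType} (s : seq R) (y : R) :
  exists2 t, y < t & all (fun x => (x <= y) || (t < x)) s.
Proof.
elim: s => [|x s [t yt st]]; first by exists (y + 1); rewrite // ltrDl.
have [xy|yx] := leP x y; first by exists t; rewrite //= xy.
exists (Num.min t ((x + y) / 2)); first by rewrite lt_min yt /=; lra.
rewrite /= gt_min; apply/andP; split; first by apply/or3P/Or33; lra.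
apply: sub_all st => z /orP[->//|tz]; by rewrite gt_min tz orbT.
Qed.

Lemma circular_arc_ivt {R : realType} {d} (S : set 'rV[R]_d) P Q w t :
  is_circular_arc S P Q -> dotp w P < t -> t < dotp w Q ->
  exists2 z, S z & dotp w z = t.
Proof.
move=> [c [r [u [v [a [b [r0 _ /andP[ab _] -> [<- <-]]]]]]]] Pt tQ.
pose f s := dotp w (circle_point c r u v s).
have fc : {within `[a, b], continuous f}%classic.
  apply: continuous_subspaceT => x.
  rewrite (_ : f = fun s => dotp w c + r * (cos s * dotp w u + sin s * dotp w v)).
    apply: cvgD; first exact: cvg_cst.
    apply: cvgM; first exact: cvg_cst.
    by apply: cvgD; apply: cvgM; (exact: cvg_cst || exact: continuous_cos ||
      exact: continuous_sin).
  by apply/funext => s; rewrite /f /circle_point !dotpE.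
have [|s sab fs] := @IVT _ f a b t (ltW ab) fc.
  by rewrite ge_min le_max (ltW Pt : f a <= t) (ltW tQ : t <= f b) orbT.
exists (circle_point c r u v s) => //; exists s => //=.
Qed.

Lemma circular_arc_sym {R : realType} {d} (S : set 'rV[R]_d) P Q :
  is_circular_arc S P Q -> is_circular_arc S Q P.
Proof.
move=> [c [r [u [v [a [b [r0 [uu vv uv] ab -> [<- <-]]]]]]]].
have cN s : circle_point c r u (- v) (- s) = circle_point c r u v s.
  by rewrite /circle_point cosN sinN scalerN scaleNr opprK.
exists c, r, u, (- v), (- b), (- a); split=> //.
- by rewrite !dotpE opprK uv oppr0.
- by lra.
- apply/seteqP; split=> z [s /= /andP[as_ sb] <-]; exists (- s).
  + by rewrite /= !lerN2 as_ sb.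
  + by rewrite cN.
  + by rewrite /= lerNr sb lerNl as_.
  + by rewrite -cN opprK.
Qed.

(** With [h] the height along a generic direction, [P] is cut off by a plane just above its highest
    vertex [M]. Each cut edge chooses a point in this plane. No two choose the same one, because
    arcs meet only in vertices and the plane contains none; each circle takes at most two of these
    points. *)
Lemma cut_le_circles {R : realType} {d} (G : sgraph) s :
  drawable_on_spheres R d G 1 s ->
  exists2 h : G -> R, injective h & forall P : {set G},
    (forall x y, x \in P -> y \notin P -> h x < h y) ->
    (#|[set e : G * G | [&& e.1 \in P, e.2 \notin P & sedge e.1 e.2]]|
       <= 2 * s)%N.
Proof.
move=> [pos [arc [S [[pos_inj arcP] [arc_vtx arc_arc] sphP cov]]]].
have [w w_inj] := exists_injective_dotp pos pos_inj.
exists (fun x => dotp w (pos x)) => // P Plow.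
have [P0|[x0 x0P]] := set_0Vmem P.
  by rewrite (_ : [set e | _] = finset.set0) ?cards0 //; apply/finset.setP => e;
    rewrite P0 !inE.
pose M := [arg max_(x > x0 | x \in P) dotp w (pos x)]%O.
have MP : M \in P by rewrite /M; case: arg_maxP.
have Mmax x : x \in P -> dotp w (pos x) <= dotp w (pos M).
  by rewrite /M; case: arg_maxP => // i _ h /h.
have [c cP] := choice (fun i => circle_section (S i) (sphP i)).
have [t Mt /allP tP] := exists_gap
  ([seq dotp w (pos x) | x <- enum G] ++ [seq dotp w (c i) | i <- enum 'I_s])
  (dotp w (pos M)).
have hP x : (dotp w (pos x) <= dotp w (pos M)) || (t < dotp w (pos x)).
  by apply: tP; rewrite mem_cat; apply/orP; left; apply/mapP; exists x; rewrite ?mem_enum.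
have tc i : t != dotp w (c i).
  have /orP[h|h] : (dotp w (c i) <= dotp w (pos M)) || (t < dotp w (c i)).
  - by apply: tP; rewrite mem_cat; apply/orP; right; apply/mapP; exists i; rewrite ?mem_enum.
  - by rewrite gt_eqF // (le_lt_trans h).
  - by rewrite lt_eqF.
have tpos x : dotp w (pos x) != t.
  have /orP[h|h] := hP x; first by rewrite lt_eqF // (le_lt_trans h).
  by rewrite gt_eqF.
set E := [set e | _].
have crossP (e : G * G) : exists z, e \in E ->
    arc [set e.1; e.2]%SET z /\ dotp w z = t.
  have [|_] := boolP (e \in E); last by exists 0.
  rewrite inE => /and3P[eP1 eP2 e12].
  have [||z az wz] := circular_arc_ivt _ _ _ w t (arcP _ _ e12).
  - by apply: le_lt_trans Mt; apply: Mmax.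
  - by case/orP: (hP e.2) => // h; move: (Plow _ _ MP eP2); rewrite ltNge h.
  - by exists z.
have [Z ZP] := choice crossP.
have E_edges e : e \in E -> [set e.1; e.2]%SET \in edges G.
  rewrite inE => /and3P[_ _ e12]; rewrite inE.
  by apply/existsP; exists e.1; apply/existsP; exists e.2; rewrite e12 eqxx.
have Z_inj e e' : e \in E -> e' \in E -> Z e = Z e' -> e = e'.
  move=> eE e'E zz; have [ez wz] := ZP e eE; have [e'z _] := ZP e' e'E.
  have [eqe|nee] := eqVneq [set e.1; e.2]%SET [set e'.1; e'.2]%SET.
    (* Pairs in [E] list their end in [P] first, so equal vertex sets give equal pairs. *)
    move: eE e'E; rewrite !inE => /and3P[p1 p2 _] /and3P[q1 q2 _].
    have h1 : e.1 \in [set e'.1; e'.2]%SET by rewrite -eqe !inE eqxx.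
    have h2 : e.2 \in [set e'.1; e'.2]%SET by rewrite -eqe !inE eqxx orbT.
    move: h1 h2; rewrite !inE => /orP[/eqP h1|/eqP h1]; last first.
      by rewrite -h1 p1 in q2.
    move=> /orP[/eqP h2|/eqP h2]; first by rewrite h2 q1 in p2.
    by rewrite [e]surjective_pairing [e']surjective_pairing h1 h2.
  rewrite -zz in e'z.
  have [x _ zx] := arc_arc _ _ _ (E_edges _ eE) (E_edges _ e'E) nee ez e'z.
  by move: (tpos x); rewrite -zx wz eqxx.
rewrite -[X in (_ <= 2 * X)%N]card_ord.
apply: (card_le_fibers _ _ E (fun e i => S i (Z e))) => [e eE|i].
  have [|i _ iz] := cov (Z e); last by exists i.
  by right; exists [set e.1; e.2]%SET; [exact: E_edges|exact: (ZP e eE).1].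
clearbody E; rewrite leqNgt; apply/card_gt2P => -[x [y [z []]]].
rewrite !inE => -[/andP[xE /asboolP xS] /andP[yE /asboolP yS]
  /andP[zE /asboolP zS]] [xy yz zx].
have w_eq e : e \in E -> dotp w (Z e) = t by move=> /ZP[].
have [eq|eq|eq] := cP i w t (tc i) _ _ _ xS yS zS (w_eq x xE) (w_eq y yE)
  (w_eq z zE).
- by rewrite (Z_inj x y xE yE eq) eqxx in xy.
- by rewrite (Z_inj x z xE zE eq) eqxx in zx.
- by rewrite (Z_inj y z yE zE eq) eqxx in yz.
Qed.

(** * Lower bounds *)

(** Take [P] of least cardinality among the downward closed sets satisfying [Q], and [x] its highest
    element: without [x] it stays downward closed, so [Q] fails. This is the moment at which the
    sweep stops. *)
Lemma exists_threshold {R : realType} {T : finType} (h : T -> R)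
    (Q : pred {set T}) :
  injective h -> ~~ Q finset.set0 -> Q [set: T]%SET ->
  exists (P : {set T}) x, [/\ x \in P, Q P, ~~ Q (P :\ x)%SET &
    forall y z, y \in P -> z \notin P -> h y < h z].
Proof.
move=> h_inj Q0 QT.
pose low (P : {set T}) :=
  [forall y in P, forall z, (z \notin P) ==> (h y < h z)].
have lowP (P : {set T}) : reflect
    (forall y z, y \in P -> z \notin P -> h y < h z) (low P).
  apply: (iffP forall_inP) => [H y z yP|H y yP].
    by move/forallP: (H y yP) => /(_ z) /implyP.
  by apply/forallP => z; apply/implyP; exact: H.
have lowT : low [set: T]%SET && Q [set: T]%SET.
  by rewrite QT andbT; apply/lowP => y z _; rewrite inE.
case: (arg_minnP (fun P : {set T} => #|P|)
  (P := fun P => low P && Q P) lowT) => P /andP[/lowP Plow QP] Pmin.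
have [P0|[x0 x0P]] := set_0Vmem P; first by rewrite P0 (negPf Q0) in QP.
case: (@arg_maxP _ _ _ x0 (mem P) h x0P) => x xP xmax.
exists P, x; split=> //; apply/negP => QPx.
suff lowPx : low (P :\ x)%SET.
  have := Pmin (P :\ x)%SET; rewrite lowPx QPx (cardsD1 x P) [x \in P]xP.
  by rewrite add1n ltnn => /(_ isT).
apply/lowP => y z.
rewrite !inE negb_and negbK => /andP[yx yP] /orP[/eqP->|]; last exact: Plow.
by rewrite lt_neqAle (inj_eq h_inj) yx /=; exact: xmax.
Qed.

(** The plane has [1 + a] vertices below and [b] above, and [a] counts those below before the last
    one is passed. The bounds leave [b = a] or [b = a + 1]; the former, with [n] odd, accounts for
    the [+ 1]. *)
Lemma half_cut_arith a b n s : (1 + a + b = n -> 2 * a < n -> n <= 2 * (1 + a) ->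
  (1 + a) * b <= 2 * s -> n ^ 2 <= 8 * s + 1)%N.
Proof.
move=> <- h1 h2 h; have [->|bE] : b = a \/ b = a.+1 by lia.
  by nia.
by rewrite bE in h *; nia.
Qed.

(** The part of size [p] has just reached half, the other has not. Twice the cut exceeds [p * q] by
    [(1 + a - a') * (b' - b)], which is nonnegative. *)
Lemma half_cut2_arith a a' b b' p q s : (1 + a + a' = p -> b + b' = q ->
  2 * a < p -> p <= 2 * (1 + a) -> 2 * b < q ->
  (1 + a) * b' + b * a' <= 2 * s -> p * q <= 4 * s)%N.
Proof.
move=> <- <- h1 h2 h3 h; have [a'E|a'E] : a' = a \/ a' = a.+1 by lia.
  by rewrite a'E in h *; nia.
by rewrite a'E in h *; nia.
Qed.

Lemma complete_graph_lower {R : realType} {d} n s : (0 < n)%N ->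
  drawable_on_spheres R d (complete_graph n) 1 s -> (n ^ 2 <= 8 * s + 1)%N.
Proof.
move=> n0 /cut_le_circles[h h_inj cut].
have [||P [x [xP QP QPx Plow]]] :=
    exists_threshold h (fun P => n <= 2 * #|P|)%N h_inj.
- by rewrite cards0 -ltnNge.
- by rewrite cardsT card_ord; lia.
rewrite -ltnNge in QPx; have := cut P Plow.
rewrite (_ : [set e | _] = finset.setX P (~: P)%SET); last first.
  apply/finset.setP => -[a b]; rewrite !inE /=.
  have [aP|//] := boolP (a \in P); have [|bP] //= := boolP (b \in P).
  by apply: contraNneq bP => <-.
rewrite cardsX; have := cardsC P; rewrite card_ord.
by rewrite (cardsD1 x P) xP in QP *; move=> cP; exact: half_cut_arith cP QPx QP.
Qed.

(** The sweep stops once one of the parts has at least half of its vertices below. The last vertex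
    passed lies in that part, and the other part is still short of half. *)
Lemma complete_bipartite_lower {R : realType} {d} p q s :
  (0 < p)%N -> (0 < q)%N ->
  drawable_on_spheres R d (complete_bipartite_graph p q) 1 s ->
  (p * q <= 4 * s)%N.
Proof.
move=> p0 q0 /cut_le_circles[h h_inj cut].
pose A (P : {set 'I_p + 'I_q}) := [set i | inl i \in P]%SET.
pose B (P : {set 'I_p + 'I_q}) := [set j | inr j \in P]%SET.
have [||P [x [xP QP QPx Plow]]] := exists_threshold h
    (fun P => (p <= 2 * #|A P|) || (q <= 2 * #|B P|))%N h_inj.
- have -> : A finset.set0 = finset.set0 by apply/finset.setP => i; rewrite !inE.
  have -> : B finset.set0 = finset.set0 by apply/finset.setP => i; rewrite !inE.
  by rewrite !cards0 muln0 !leqn0 negb_or -!lt0n p0.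
- have -> : A [set: _]%SET = [set: _]%SET by apply/finset.setP => i; rewrite !inE.
  by rewrite cardsT card_ord leq_pmull.
have := cut P Plow.
pose f (e : 'I_p * 'I_q) := (inl e.1 : 'I_p + 'I_q, inr e.2 : 'I_p + 'I_q).
pose g (e : 'I_q * 'I_p) := (inr e.1 : 'I_p + 'I_q, inl e.2 : 'I_p + 'I_q).
have f_inj : injective f by move=> [a b] [a' b'] [-> ->].
have g_inj : injective g by move=> [a b] [a' b'] [-> ->].
rewrite (_ : [set e | _] = (f @: finset.setX (A P) (~: B P)) :|:
    (g @: finset.setX (B P) (~: A P)))%SET; last first.
  apply/finset.setP => -[[i|j] [i'|j']]; rewrite !inE /=; apply/idP/idP.
  - by rewrite !andbF.
  - by move=> /orP[] /imsetP[[a b] _ []].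
  - by rewrite andbT => H; apply/orP; left; apply/imsetP; exists (i, j');
      rewrite ?inE.
  - by move=> /orP[] /imsetP[[a b]]; rewrite !inE /= => H [-> ->]; rewrite andbT.
  - by rewrite andbT => H; apply/orP; right; apply/imsetP; exists (j, i');
      rewrite ?inE.
  - by move=> /orP[] /imsetP[[a b]]; rewrite !inE /= => H [-> ->]; rewrite andbT.
  - by rewrite !andbF.
  - by move=> /orP[] /imsetP[[a b] _ []].
rewrite cardsU (_ : _ :&: _ = finset.set0)%SET; last first.
  apply/finset.setP => e; rewrite !inE; apply/negP => /andP[/imsetP[a _ ->]].
  by move=> /imsetP[b _ []].
rewrite cards0 subn0 !card_imset // !cardsX.
have := cardsC (A P); have := cardsC (B P); rewrite !card_ord => cB cA.
move: QPx; rewrite negb_or -!ltnNge; case: x xP => [i|j] xP.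
  have -> : A (P :\ inl i)%SET = (A P :\ i)%SET.
    by apply/finset.setP => k; rewrite !inE.
  have -> : B (P :\ inl i)%SET = B P by apply/finset.setP => k; rewrite !inE.
  move: QP; rewrite (cardsD1 i (A P)) inE xP in cA *; move=> QP /andP[hA hB] hc.
  apply: (half_cut2_arith _ _ _ _ _ _ _ cA cB hA _ hB hc).
  by case/orP: QP => //; rewrite leqNgt hB.
have -> : B (P :\ inr j)%SET = (B P :\ j)%SET.
  by apply/finset.setP => k; rewrite !inE.
have -> : A (P :\ inr j)%SET = A P by apply/finset.setP => k; rewrite !inE.
move: QP; rewrite (cardsD1 j (B P)) inE xP in cB *; move=> QP /andP[hA hB] hc.
rewrite mulnC; rewrite addnC in hc; apply: (half_cut2_arith _ _ _ _ _ _ _ cB cA hB _ hA hc).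
by case/orP: QP => //; rewrite leqNgt hA.
Qed.

(** * Circular arcs *)

(** Gram-Schmidt, applied to [D] first, so that [v] points along [D] and [u] to the side of [M]. *)
Lemma orthonormal_frame {R : realType} {d} (M D : 'rV[R]_d) :
  D != 0 -> (forall k, M != k *: D) ->
  exists u v m1 m2 l, [/\ [/\ dotp u u = 1, dotp v v = 1 & dotp u v = 0],
    D = l *: v, M = m1 *: u + m2 *: v, 0 < m1 & 0 < l].
Proof.
move=> D0 MD; pose l := Num.sqrt (dotp D D).
have l0 : 0 < l by rewrite sqrtr_gt0 dotp_gt0.
have lD : dotp D D = l ^+ 2 by rewrite sqr_sqrtr ?dotp_ge0.
pose v := l^-1 *: D; pose m2 := dotp M v; pose n := M - m2 *: v.
have vv : dotp v v = 1 by rewrite !dotpE lD; field; rewrite gt_eqF.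
have n0 : n != 0.
  by apply: contra (MD (m2 * l^-1)); rewrite subr_eq0 scalerA.
pose m1 := Num.sqrt (dotp n n).
have m1_gt0 : 0 < m1 by rewrite sqrtr_gt0 dotp_gt0.
have nn : dotp n n = m1 ^+ 2 by rewrite sqr_sqrtr ?dotp_ge0.
have nv : dotp n v = 0.
  by rewrite /n dotpDl dotpNl dotpZl vv mulr1 subrr.
exists (m1^-1 *: n), v, m1, m2, l; split=> //.
- split=> //; last by rewrite dotpZl nv mulr0.
  by rewrite dotpZl dotpZr nn; field; rewrite gt_eqF.
- by rewrite scalerA divff ?scale1r // gt_eqF.
- by rewrite scalerA divff ?scale1r ?subrK // gt_eqF.
Qed.

Lemma dotp_frame {R : realType} {d} (u v : 'rV[R]_d) (a b : R) :
  [/\ dotp u u = 1, dotp v v = 1 & dotp u v = 0] ->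
  dotp (a *: u + b *: v) (a *: u + b *: v) = a ^+ 2 + b ^+ 2.
Proof. by move=> [uu vv uv]; rewrite !dotpE (dotpC v u) uu vv uv; ring. Qed.

Lemma abs_le_acos {R : realType} (k t : R) : -1 < k < 1 ->
  `|t| <= pi -> (`|t| <= acos k) = (k <= cos t).
Proof.
move=> /andP[k1 k2] tpi; have k_itv : k \in `[-1, 1] by rewrite in_itv /= !ltW.
have [/andP[a0 api] ca] := acos_def k_itv.
rewrite -(cos_norm t) -{2}ca !leNgt ltr_cos //; rewrite in_itv /= ?normr_ge0 //.
by rewrite a0 api.
Qed.

(** The chord lies on the line [a = 0], so [0 <= a] selects the part of the circle on the side of
    [M]. In a frame with [v] along the chord this becomes [k <= cos t], that is, [|t| <= acos k]. *)
Lemma chord_arc {R : realType} {d} (P M D : 'rV[R]_d) (c1 c2 r : R) :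
  0 < r -> D != 0 -> (forall k, M != k *: D) ->
  let c := P + (c1 *: M + c2 *: D) in
  dotp (P - c) (P - c) = r ^+ 2 -> dotp (P + D - c) (P + D - c) = r ^+ 2 ->
  is_circular_arc [set x | exists a b, [/\ 0 <= a, x = P + (a *: M + b *: D) &
    dotp (x - c) (x - c) = r ^+ 2]]%classic P (P + D).
Proof.
move=> r0 D0 MD c.
have [u [v [m1 [m2 [l [frame DE ME m1_gt0 l0]]]]]] := orthonormal_frame M D D0 MD.
have subc a b : P + (a *: M + b *: D) - c =
    ((a - c1) * m1) *: u + ((a - c1) * m2 + (b - c2) * l) *: v.
  by apply/rowP => i; rewrite /c ME DE !mxE; ring.
have nsubc a b := dotp_frame u v ((a - c1) * m1)
  ((a - c1) * m2 + (b - c2) * l) frame.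
have PE : P = P + (0 *: M + 0 *: D) by rewrite !scale0r !addr0.
have QE : P + D = P + (0 *: M + 1 *: D) by rewrite scale0r scale1r add0r.
rewrite {1 2}PE QE !subc !nsubc => hP hQ.
(* The centre is equidistant from the ends of the chord, hence projects to its midpoint. *)
have Y0 : c1 * m2 + c2 * l = l / 2 by apply: (mulIf (lt0r_neq0 l0)); nra.
(* In units of [r], [k] is the signed distance of the chord from the centre and [h] half its length.
   As [h > 0], [k] is strictly between -1 and 1, which makes the arc proper and nondegenerate. *)
pose k := - (c1 * m1) / r; pose h := l / (2 * r).
have h0 : 0 < h by rewrite divr_gt0 ?mulr_gt0.
have kh : k ^+ 2 + h ^+ 2 = 1.
  have -> : 1 = r ^+ 2 / r ^+ 2 :> R by rewrite divff // sqrf_eq0 gt_eqF.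
  rewrite -{1}hP (_ : (0 - c1) * m2 + _ = - (l / 2)); last by lra.
  by rewrite /k /h; field; rewrite gt_eqF.
have kb : -1 < k < 1 by apply/andP; split; nra.
have kc : -1 <= k <= 1 by case/andP: kb => *; rewrite !ltW.
have sk : sin (acos k) = h.
  rewrite sin_acos // (_ : 1 - k ^+ 2 = h ^+ 2); last by lra.
  by rewrite sqrtr_sqr gtr0_norm.
have ck : cos (acos k) = k by rewrite acosK // in_itv.
exists c, r, u, v, (- acos k), (acos k); split=> //.
- have a0 : 0 < acos k by apply: acos_gt0; case/andP: kb => *; rewrite ltW.
  have api : acos k < pi by apply: acos_ltpi; case/andP: kb => -> /ltW ->.
  by lra.
- apply/seteqP; split=> x /=.
  + move=> [a [b [a0 -> ]]]; rewrite subc nsubc.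
    set X := (a - c1) * m1; set Y := (a - c1) * m2 + _ => XY.
    have Xr : (X / r) ^+ 2 + (Y / r) ^+ 2 = 1.
      by rewrite !expr_div_n -mulrDl XY divff // sqrf_eq0 gt_eqF.
    have Xb : -1 <= X / r <= 1 by apply/andP; split; nra.
    have Xk : k <= X / r.
      by rewrite ler_pM2r ?invr_gt0 // /X mulrBl addrC lerDl mulr_ge0 // ltW.
    have [/andP[A0 Api] cA] := acos_def Xb.
    have sA : sin (acos (X / r)) = `|Y / r|.
      rewrite sin_acos // (_ : 1 - _ = (Y / r) ^+ 2) ?sqrtr_sqr //; lra.
    have Ak : `|acos (X / r)| <= acos k.
      by rewrite abs_le_acos // ?cA // ger0_norm.
    rewrite ger0_norm // in Ak.
    have xE : c + (X *: u + Y *: v) = P + (a *: M + b *: D).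
      by rewrite /X /Y -subc addrC subrK.
    have rK y : r * (y / r) = y by rewrite mulrC divfK // gt_eqF.
    have [Yr|Yr] := ger0P (Y / r).
      exists (acos (X / r)); first by rewrite /= Ak andbT; lra.
      by rewrite /circle_point cA sA ger0_norm // scalerDr !scalerA !rK.
    exists (- acos (X / r)); first by rewrite /= lerN2 Ak; lra.
    rewrite /circle_point cosN sinN cA sA ltr0_norm // opprK.
    by rewrite scalerDr !scalerA !rK.
  + move=> [t /andP[t1 t2] <-].
    have tk : `|t| <= acos k by rewrite ler_norml t1 t2.
    have kt : k <= cos t.
      by rewrite -abs_le_acos // (le_trans tk) // acos_lepi.
    pose a := r * (cos t - k) / m1.
    exists a, (c2 + (r * sin t - (a - c1) * m2) / l).
    have E : circle_point c r u v t =
        P + (a *: M + (c2 + (r * sin t - (a - c1) * m2) / l) *: D).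
      rewrite -[RHS](subrK c) subc addrC /circle_point scalerDr !scalerA.
      congr (_ + (_ *: _ + _ *: _)); rewrite /a /k; field;
        rewrite ?gt_eqF //.
    split=> //.
      by rewrite /a divr_ge0 ?mulr_ge0 ?subr_ge0 // ltW.
    rewrite /circle_point addrC addKr scalerDr !scalerA dotp_frame //.
    by rewrite !exprMn -mulrDr cos2Dsin2 mulr1.
- rewrite /circle_point cosN sinN ck sk; split.
    rewrite -[RHS](subrK c) PE subc addrC scalerDr !scalerA.
    congr (_ *: _ + _ *: _ + _); rewrite /k /h.
      by field; rewrite gt_eqF.
    rewrite (_ : r * - _ = - (l / 2)); first by lra.
    by field; rewrite gt_eqF.
  rewrite -[RHS](subrK c) subc addrC scalerDr !scalerA.
  congr (_ *: _ + _ *: _ + _); rewrite /k /h.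
    by field; rewrite gt_eqF.
  rewrite (_ : r * _ = l / 2); first by lra.
  by field; rewrite gt_eqF.
Qed.

Definition indep {R : realType} {d} (y z : 'rV[R]_d) :=
  forall a b : R, a *: y + b *: z = 0 -> a = 0 /\ b = 0.

(* The circle in the plane spanned by [y] and [z] whose image in [S^3] under
   inverse stereographic projection is a great circle. *)
Definition qcircle {R : realType} {d} (y z : 'rV[R]_d) (wy wz : R) :
    set 'rV[R]_d :=
  [set x | exists a b, x = a *: y + b *: z /\ dotp x x - 1 = a * wy + b * wz]%classic.

Lemma indep_neq0l {R : realType} {d} (y z : 'rV[R]_d) : indep y z -> y != 0.
Proof.
move=> yz; apply/eqP => y0; have [|/eqP] := yz 1 0.
  by rewrite y0 scaler0 scale0r addr0.
by rewrite oner_eq0.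
Qed.

Lemma indep_sym {R : realType} {d} (y z : 'rV[R]_d) : indep y z -> indep z y.
Proof. by move=> yz a b; rewrite addrC => /yz[]. Qed.

Lemma qcircle_center {R : realType} {d} (y z : 'rV[R]_d) (wy wz : R) :
  indep y z -> exists c1 c2 r, 0 < r /\ forall a b,
    let x := a *: y + b *: z in let c := c1 *: y + c2 *: z in
    dotp x x - 1 = a * wy + b * wz <-> dotp (x - c) (x - c) = r ^+ 2.
Proof.
move=> yz; have z0 := indep_neq0l _ _ (indep_sym _ _ yz).
rewrite -dotp_gt0 in z0.
pose G := dotp y y * dotp z z - dotp y z ^+ 2.
have G0 : G != 0.
  have : dotp z z *: y + (- dotp y z) *: z != 0.
    by apply/eqP => /yz[/eqP]; rewrite gt_eqF.
  apply: contra => /eqP G0; rewrite -dotp_eq0 !dotpE (dotpC z y).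
  apply/eqP; transitivity (dotp z z * G); last by rewrite G0 mulr0.
  by rewrite /G; ring.
pose c1 := (wy * dotp z z - wz * dotp y z) / (2 * G).
pose c2 := (wz * dotp y y - wy * dotp y z) / (2 * G).
have cy : c1 * dotp y y + c2 * dotp y z = wy / 2.
  by rewrite /c1 /c2 /G; field.
have cz : c1 * dotp y z + c2 * dotp z z = wz / 2.
  by rewrite /c1 /c2 /G; field.
pose c := c1 *: y + c2 *: z.
have r0 : 0 < 1 + dotp c c by rewrite ltr_pwDl ?dotp_ge0.
exists c1, c2, (Num.sqrt (1 + dotp c c)); split; first by rewrite sqrtr_gt0.
move=> a b x; rewrite -/c sqr_sqrtr ?ltW //= -/c.
have -> : dotp (x - c) (x - c) = dotp x x - (a * wy + b * wz) + dotp c c.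
  transitivity (dotp x x - 2 * (a * (c1 * dotp y y + c2 * dotp y z) +
    b * (c1 * dotp y z + c2 * dotp z z)) + dotp c c).
    by rewrite !dotpE (dotpC z y); ring.
  by rewrite cy cz; field.
by split; lra.
Qed.

Lemma is_sphere_qcircle {R : realType} {d} (y z : 'rV[R]_d) (wy wz : R) :
  indep y z -> is_sphere 1 (qcircle y z wy wz).
Proof.
move=> yz; have [c1 [c2 [r [r0 H]]]] := qcircle_center y z wy wz yz.
pose W : 'M[R]_(2, d) := col_mx y z.
have WE (u : 'rV[R]_(1 + 1)) : u *m W = u 0 0 *: y + u 0 1 *: z.
  rewrite -[u in LHS]hsubmxK mul_row_col [lsubmx u]mx11_scalar.
  rewrite [rsubmx u]mx11_scalar !mul_scalar_mx !mxE.
  by congr (u _ _ *: _ + u _ _ *: _); apply: val_inj.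
exists (c1 *: y + c2 *: z), r, W; split=> //.
  apply: inj_row_free => u; rewrite WE => /yz[u0 u1]; apply/rowP => i.
  rewrite mxE; case: i => -[|[|//]] hi.
    by rewrite -[RHS]u0; congr (u _ _); apply: val_inj.
  by rewrite -[RHS]u1; congr (u _ _); apply: val_inj.
apply/seteqP; split=> x /=.
  move=> [a [b [-> /H xr]]]; split=> //; apply/submxP.
  exists (\row_i if i == 0 then a - c1 else b - c2); rewrite WE !mxE /=.
  by apply/rowP => i; rewrite !mxE; ring.
move=> [/submxP[u xE] xr]; rewrite WE in xE.
exists (u 0 0 + c1), (u 0 1 + c2).
have xE' : x = (u 0 0 + c1) *: y + (u 0 1 + c2) *: z.
  by rewrite -[LHS](subrK (c1 *: y + c2 *: z)) xE; apply/rowP => i;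
    rewrite !mxE; ring.
by split=> //; rewrite xE'; apply/H; rewrite -xE'.
Qed.

(** The weights [|P|^2 - 1] and [|Q|^2 - 1] put [P] and [Q] on the circle; nonnegative combinations
    form the shorter great-circle arc between their images in [S^3]. This is [chord_arc] with
    [M = P] and [D = Q - P]. *)
Lemma cone_arc {R : realType} {d} (P Q : 'rV[R]_d) : indep P Q ->
  is_circular_arc [set x | exists a b, [/\ 0 <= a, 0 <= b, x = a *: P + b *: Q &
    dotp x x - 1 = a * (dotp P P - 1) + b * (dotp Q Q - 1)]]%classic P Q.
Proof.
move=> PQ; set w1 := dotp P P - 1; set w2 := dotp Q Q - 1.
have [c1 [c2 [r [r0 H]]]] := qcircle_center P Q w1 w2 PQ.
pose D := Q - P.
have D0 : D != 0.
  apply/eqP => D0; have [|/eqP] := PQ (-1) 1; last by rewrite oppr_eq0 oner_eq0.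
  by rewrite scaleN1r scale1r addrC.
have PD k : P != k *: D.
  apply/eqP => PE; have [|k1 k0] := PQ (1 + k) (- k).
    rewrite scalerDl scale1r {1}PE; apply/rowP => i; rewrite !mxE; ring.
  by lra.
have cE : c1 *: P + c2 *: Q = P + ((c1 + c2 - 1) *: P + c2 *: D).
  by apply/rowP => i; rewrite !mxE; ring.
have xE a b : P + (a *: P + b *: D) = (1 + a - b) *: P + b *: Q.
  by apply/rowP => i; rewrite !mxE; ring.
have DQ : P + D = Q by rewrite addrC subrK.
pose c := c1 *: P + c2 *: Q.
have hP : dotp (P - c) (P - c) = r ^+ 2.
  by have := (H 1 0).1; rewrite scale1r scale0r addr0 mul1r mul0r addr0; apply.
have hQ : dotp (Q - c) (Q - c) = r ^+ 2.
  by have := (H 0 1).1; rewrite scale1r scale0r add0r mul1r mul0r add0r; apply.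
have := chord_arc P P D (c1 + c2 - 1) c2 r r0 D0 PD.
rewrite /= -cE DQ => /(_ hP hQ); congr is_circular_arc.
have D_gt0 := dotp_gt0 D; rewrite D0 in D_gt0.
have DD : dotp D D = dotp P P + dotp Q Q - 2 * dotp P Q.
  by rewrite /D !dotpE (dotpC Q P); ring.
(* This identity shows that on the circle the cone [0 <= a, 0 <= b] is the
   half-plane [1 <= a + b] beyond the chord. *)
have key a b : let x := a *: P + b *: Q in dotp x x - 1 = a * w1 + b * w2 ->
    (a + b - 1) * (a * dotp P P + b * dotp Q Q + 1) = a * b * dotp D D /\
    dotp x x = a * dotp P P + b * dotp Q Q + 1 - (a + b).
  rewrite /= DD /w1 /w2 => xx; split; last by lra.
  by move: xx; rewrite !dotpE (dotpC Q P) => xx; nra.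
apply/seteqP; split=> x /=.
  move=> [a [b [a0 -> ]]]; rewrite xE => /H xx.
  exists (1 + a - b), b; have [] := key _ _ xx.
  have := dotp_ge0 ((1 + a - b) *: P + b *: Q).
  set K := (_ + 1) => X0 hK hX.
  have K0 : 0 < K by lra.
  have ab : 0 <= (1 + a - b) * b.
    by rewrite -(pmulr_lge0 _ D_gt0) -hK mulr_ge0 ?(ltW K0) //; lra.
  (* The two coefficients have nonnegative product and sum at least 1, so neither is negative. *)
  by split=> //; nra.
move=> [a [b [a0 b0 xE' xx]]]; rewrite xE' in xx *.
have [] := key _ _ xx; set K := (_ + 1) => hK hX.
have K0 : 0 < K by rewrite ltr_wpDl // addr_ge0 // mulr_ge0 // dotp_ge0.
exists (a + b - 1), b; split.
- by rewrite -(pmulr_lge0 _ K0) hK !mulr_ge0 // ltW.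
- by rewrite xE; congr (_ *: _ + _); ring.
- by apply/H.
Qed.

(** In [S^3], [Q] is the antipode of [P]. The chord lies on the line of multiples of [P], so
    [0 <= b] is the half circle on the side of [z]. *)
Lemma half_arc {R : realType} {d} (P Q z : 'rV[R]_d) (w : R) : indep P z ->
  Q = - (dotp P P)^-1 *: P ->
  is_circular_arc [set x | exists a b, [/\ 0 <= b, x = a *: P + b *: z &
    dotp x x - 1 = a * (dotp P P - 1) + b * w]]%classic P Q.
Proof.
move=> Pz ->; set p := dotp P P.
have p0 : 0 < p by rewrite dotp_gt0 (indep_neq0l _ _ Pz).
have [c1 [c2 [r [r0 H]]]] := qcircle_center P z (p - 1) w Pz.
pose k := - p^-1 - 1; pose D := k *: P.
have k0 : k < 0 by rewrite /k subr_lt0 (@lt_trans _ _ 0) // oppr_lt0 invr_gt0.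
have k_neq0 : k != 0 by rewrite lt_eqF.
have D0 : D != 0 by rewrite scaler_eq0 negb_or k_neq0 (indep_neq0l _ _ Pz).
have zD l : z != l *: D.
  apply/eqP => zE; have [|_ /eqP] := Pz (l * k) (-1).
    by rewrite scaleN1r -scalerA -/D -zE subrr.
  by rewrite oppr_eq0 oner_eq0.
have xE a b : P + (a *: z + b *: D) = (1 + b * k) *: P + a *: z.
  by apply/rowP => i; rewrite !mxE; ring.
have cE : c1 *: P + c2 *: z = P + (c2 *: z + (c1 - 1) / k *: D).
  by rewrite xE divfK // [1 + _]addrC subrK.
have DQ : P + D = - p^-1 *: P by apply/rowP => i; rewrite !mxE /k; ring.
pose c := c1 *: P + c2 *: z.
have hP : dotp (P - c) (P - c) = r ^+ 2.
  by have := (H 1 0).1; rewrite scale1r scale0r addr0 mul1r mul0r addr0; apply.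
have hQ : dotp (P + D - c) (P + D - c) = r ^+ 2.
  have := (H (- p^-1) 0).1; rewrite scale0r addr0 mul0r addr0 DQ; apply.
  by rewrite dotpZl dotpZr -/p; field; rewrite gt_eqF.
have := chord_arc P z D c2 ((c1 - 1) / k) r r0 D0 zD.
rewrite /= -cE => /(_ hP hQ); rewrite DQ; congr is_circular_arc.
apply/seteqP; split=> x /=.
  by move=> [a [b [a0 ->]]]; rewrite xE => /H xx; exists (1 + b * k), a.
move=> [a [b [b0 -> /H xx]]]; exists b, ((a - 1) / k).
by rewrite xE divfK // [1 + _]addrC subrK.
Qed.

(** * Great circles in general position *)

(** Vandermonde argument: the polynomial vanishing at all nodes of [S] except [t k] has size at most
    [n], so its values weighted by [g] sum to 0, and only the term at [k] survives. *)
Lemma moments_eq0 {R : realType} {J : finType} (t g : J -> R) (S : {set J}) n :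
  injective t -> (forall k, g k != 0 -> k \in S) -> (#|S| <= n)%N ->
  (forall m, (m < n)%N -> \sum_k g k * t k ^+ m = 0) -> forall k, g k = 0.
Proof.
move=> t_inj gS Sn mom k.
have [kS|kS] := boolP (k \in S); last by apply: contraNeq kS => /gS.
pose Q := \prod_(i <- enum (S :\ k)%SET) ('X - (t i)%:P).
have sQ : (size Q <= n)%N.
  rewrite size_prod_XsubC -cardE; apply: leq_trans Sn.
  by rewrite (cardsD1 k S) kS.
have : \sum_j g j * Q.[t j] = 0.
  under eq_bigr => j _ do rewrite (horner_coef_wide _ sQ) mulr_sumr.
  rewrite exchange_big /= big1 // => m _.
  under eq_bigr => j _ do rewrite mulrCA.
  by rewrite -mulr_sumr mom // mulr0.
rewrite (bigD1 k) //= big1 ?addr0 => [/eqP|j jk].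
  rewrite mulf_eq0 => /orP[/eqP//|]; rewrite horner_prod big_seq prodf_seq_eq0.
  move=> /hasP[i]; rewrite mem_enum => iS /andP[_].
  rewrite hornerXsubC subr_eq0 (inj_eq t_inj) => /eqP ki.
  by rewrite !inE ki eqxx in iS.
have [jS|jS] := boolP (j \in S); last first.
  by rewrite (_ : g j = 0) ?mul0r //; apply: contraNeq jS => /gS.
rewrite horner_prod (bigD1_seq j) ?enum_uniq ?mem_enum ?inE ?jk //=.
by rewrite hornerXsubC subrr mul0r mulr0.
Qed.

Definition sgn {R : realType} (e : bool) : R := if e then 1 else -1.

(** With [moment_wt] as fourth coordinate, this is the point of the moment curve in [R^4] at
    parameter [enum_rank k]; any four such points are linearly independent. *)
Definition moment_vec {R : realType} {J : finType} (k : J) : 'rV[R]_3 :=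
  \row_i (enum_rank k)%:R ^+ i.

Definition moment_wt {R : realType} {J : finType} (k : J) : R :=
  (enum_rank k)%:R ^+ 3.

Definition represents {R : realType} {J : finType} (g : J -> R) (x : 'rV[R]_3) :=
  x = \sum_k g k *: moment_vec k /\ dotp x x - 1 = \sum_k g k * moment_wt k.

(** Three moments of [g - g'] vanish by comparing points, a fourth by comparing weights, and at most
    four indices are involved. *)
Lemma represents_inj {R : realType} {J : finType} (g g' : J -> R) x
    (S S' : {set J}) :
  represents g x -> represents g' x ->
  (forall k, g k != 0 -> k \in S) -> (forall k, g' k != 0 -> k \in S') ->
  (#|S :|: S'| <= 4)%N -> g =1 g'.
Proof.
move=> [gx gw] [gx' gw'] gS gS' SS k; apply/eqP; rewrite -subr_eq0; apply/eqP.
pose t (k : J) : R := (enum_rank k)%:R.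
have t_inj : injective t.
  by move=> a b /eqP; rewrite eqr_nat => /eqP/val_inj/enum_rank_inj.
apply: (moments_eq0 t (fun k => g k - g' k) (S :|: S')%SET 4 t_inj) => //.
  move=> j; rewrite inE; apply: contraNT; rewrite negb_or => /andP[jS jS'].
  have -> : g j = 0 by apply: contraNeq jS => /gS.
  have -> : g' j = 0 by apply: contraNeq jS' => /gS'.
  by rewrite subrr.
move=> m m4; under eq_bigr => j _ do rewrite mulrBl.
rewrite sumrB; have [m3|m3] := ltnP m 3; last first.
  have -> : m = 3%N by lia.
  by rewrite -[X in X - _]gw -[X in _ - X]gw' subrr.
have coordE (h : J -> R) : (\sum_k h k *: moment_vec k) 0 (Ordinal m3) =
    \sum_j h j * t j ^+ m.
  by rewrite summxE; apply: eq_bigr => j _; rewrite !mxE.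
by rewrite -!coordE -gx -gx' subrr.
Qed.

Lemma sum_supp2 {J : finType} {V : zmodType} (k l : J)
    (F : J -> V) : k != l -> (forall j, j != k -> j != l -> F j = 0) ->
  \sum_j F j = F k + F l.
Proof.
move=> kl F0; rewrite (bigD1 k) //= (bigD1 l) 1?eq_sym //= big1 ?addr0 //.
by move=> j /andP[]; exact: F0.
Qed.

Lemma indep_moment_vec {R : realType} {J : finType} (k l : J) :
  k != l -> @indep R _ (moment_vec k) (moment_vec l).
Proof.
move=> kl a b; pose g j := if j == k then a else if j == l then b else 0.
pose t (k : J) : R := (enum_rank k)%:R.
have t_inj : injective t.
  by move=> i j /eqP; rewrite eqr_nat => /eqP/val_inj/enum_rank_inj.
have gk : g k = a by rewrite /g eqxx.
have gl : g l = b by rewrite /g eq_sym (negPf kl) eqxx.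
have g0 j : j != k -> j != l -> g j = 0 by rewrite /g => /negPf-> /negPf->.
move=> ab; rewrite -gk -gl.
suff g_eq0 : forall j, g j = 0 by rewrite !g_eq0.
apply: (moments_eq0 t g [set k; l]%SET 3 t_inj).
- move=> j; rewrite !inE; apply: contraNT; rewrite negb_or => /andP[jk jl].
  by rewrite g0.
- by rewrite cards2; case: (_ == _).
move=> m m3; rewrite (sum_supp2 k l) // => [|j jk jl].
  by move/rowP/(_ (Ordinal m3)): ab; rewrite gk gl !mxE.
by rewrite g0 ?mul0r.
Qed.

(** A root of [A * X^2 - w * X - 1]: this multiple of the moment vector lies on every circle spanned
    with index [k]. The positive and the negative root give antipodal points of [S^3]. *)
Definition moment_root {R : realType} {J : finType} (k : J) (e : bool) : R :=
  let A : R := dotp (moment_vec k) (moment_vec k) in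
  (moment_wt k + sgn e * Num.sqrt (moment_wt k ^+ 2 + 4 * A)) / (2 * A).

Lemma moment_vec_gt0 {R : realType} {J : finType} (k : J) :
  0 < dotp (moment_vec k) (moment_vec k) :> R.
Proof.
rewrite dotp_gt0; apply/eqP => /rowP/(_ 0)/eqP.
by rewrite !mxE expr0 oner_eq0.
Qed.

Lemma moment_root_sgn {R : realType} {J : finType} (k : J) (e : bool) :
  0 < sgn e * moment_root k e :> R.
Proof.
have A0 := @moment_vec_gt0 R J k; rewrite /moment_root.
set A := dotp _ _ in A0 *; set w := moment_wt k.
rewrite mulrA divr_gt0 //; last by rewrite mulr_gt0.
have h : `|w| < Num.sqrt (w ^+ 2 + 4 * A).
  by rewrite -sqrtr_sqr ltr_sqrt; have := sqr_ge0 w; lra.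
move: h; rewrite ltr_norml => /andP[h1 h2]; rewrite /sgn; case: e => /=; lra.
Qed.

Lemma moment_rootE {R : realType} {J : finType} (k : J) (e : bool) :
  moment_root k e ^+ 2 * dotp (moment_vec k) (moment_vec k) - 1 =
  moment_root k e * moment_wt k :> R.
Proof.
have A0 := @moment_vec_gt0 R J k; rewrite /moment_root.
set A := dotp _ _ in A0 *; set w := moment_wt k.
have := @sqr_sqrtr R (w ^+ 2 + 4 * A); set r := Num.sqrt _ => rE.
have {}rE : r ^+ 2 = w ^+ 2 + 4 * A by apply: rE; have := sqr_ge0 w; lra.
have e2 : sgn e ^+ 2 = 1 :> R by rewrite /sgn; case: e; rewrite ?sqrrN expr1n.
rewrite (_ : _ ^+ 2 * A = (w ^+ 2 + 2 * w * (sgn e * r) + sgn e ^+ 2 * r ^+ 2)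
  / (4 * A)); last by field; rewrite gt_eqF.
by rewrite e2 rE; field; rewrite gt_eqF.
Qed.

(** The product of the two roots is negative, so each sign occurs once. *)
Lemma moment_root_uniq {R : realType} {J : finType} (k : J) (e : bool) (l : R) :
  0 < sgn e * l ->
  l ^+ 2 * dotp (moment_vec k) (moment_vec k) - 1 = l * moment_wt k ->
  l = moment_root k e.
Proof.
move=> l0 lE; have A0 := @moment_vec_gt0 R J k.
have sE := @moment_rootE R J k e; have s0 := @moment_root_sgn R J k e.
move: (moment_root k e) sE s0 => s.
move: (dotp _ _) (moment_wt k) A0 lE => A w A0 lE sE s0.
apply/eqP; rewrite -subr_eq0; apply/eqP.
have ls : 0 < l * s by move: l0 s0; rewrite /sgn; case: e => /=; nra.
have : (l - s) * (1 + l * s * A) = 0.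
  transitivity (s * (l ^+ 2 * A - 1) - l * (s ^+ 2 * A - 1)); first by ring.
  by rewrite lE sE; ring.
move/eqP; rewrite mulf_eq0 => /orP[/eqP//|/eqP h].
have : 0 < l * s * A by rewrite mulr_gt0.
lra.
Qed.

Definition moment_pos {R : realType} {J : finType} (v : J * bool) : 'rV[R]_3 :=
  moment_root v.1 v.2 *: moment_vec v.1.

(* Points are described by the signs of their coordinates in general position;
   as these are unique when few are nonzero, intersecting two arcs amounts to
   intersecting their sets of signed labels. *)
Definition moment_arc {R : realType} {J : finType} (E : {set J * bool}) :
    set 'rV[R]_3 :=
  [set x | exists g, represents g x /\
    forall k, g k != 0 -> exists2 e, (k, e) \in E & 0 < sgn e * g k]%classic.

Lemma sgn_inj {R : realType} (e e' : bool) (a : R) :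
  0 < sgn e * a -> 0 < sgn e' * a -> e = e'.
Proof. by rewrite /sgn; case: e; case: e' => //=; lra. Qed.

Lemma moment_root_neq0 {R : realType} {J : finType} (k : J) e :
  moment_root k e != 0 :> R.
Proof.
by apply: contraTneq (@moment_root_sgn R J k e) => ->; rewrite mulr0 ltxx.
Qed.

(** The two descriptions of [x] involve at most four indices together, so their coordinates agree,
    and hence the signs. *)
Lemma moment_arc_meet {R : realType} {J : finType} (E F : {set J * bool})
    (x : 'rV[R]_3) :
  (#|[set v.1 | v in E]%SET| <= 2)%N -> (#|[set v.1 | v in F]%SET| <= 2)%N ->
  moment_arc E x -> moment_arc F x -> moment_arc (E :&: F)%SET x.
Proof.
move=> E2 F2 [g [gx gE]] [g' [gx' gF]]; exists g; split=> // k gk0.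
have gg' : g =1 g'.
  apply: (represents_inj g g' x [set v.1 | v in E]%SET [set v.1 | v in F]%SET)
      => // [j /gE[e je _]|j /gF[e je _]|].
  - by apply/imsetP; exists (j, e).
  - by apply/imsetP; exists (j, e).
  - by rewrite (leq_trans (leq_card_setU _ _)) // (leq_add E2 F2).
have [e ke e0] := gE k gk0; have [|e' ke' e0'] := gF k; first by rewrite -gg'.
rewrite -gg' in e0'; exists e => //.
by rewrite inE ke (sgn_inj _ _ _ e0 e0').
Qed.

Lemma moment_arc_card1 {R : realType} {J : finType} (E : {set J * bool})
    (x : 'rV[R]_3) :
  (#|E| <= 1)%N -> moment_arc E x -> exists2 v, v \in E & x = moment_pos v.
Proof.
move=> /card_le1_eqP E1 [g [[xE wE] gE]].
have [[k gk]|g0] := pselect (exists k, g k != 0); last first.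
  have {}g0 k : g k = 0.
    by apply/eqP/negPn/negP => gk; apply: g0; exists k.
  (* With all coordinates zero, [x] would be the origin, where [|x|^2 - 1] is -1 and not 0. *)
  move: wE; rewrite xE big1 => [|k _]; last by rewrite g0 scale0r.
  rewrite big1 => [/eqP|k _]; last by rewrite g0 mul0r.
  by rewrite -[0 : 'rV_3](scale0r 0) dotpZl mul0r sub0r oppr_eq0 oner_eq0.
have [e ke e0] := gE k gk; exists (k, e) => //.
have g0 j : j != k -> g j = 0.
  move=> jk; apply/eqP/negPn/negP => /gE[e' je' _].
  by have [jk'] := E1 _ _ je' ke; rewrite jk' eqxx in jk.
move: xE wE; rewrite (bigD1 k) //= big1 ?addr0 => [xE|j /g0->]; last first.
  by rewrite scale0r.
rewrite (bigD1 k) //= big1 ?addr0 => [wE|j /g0->]; last by rewrite mul0r.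
rewrite xE; congr (_ *: _); apply: moment_root_uniq e0 _.
by rewrite -wE xE dotpZl dotpZr mulrA -expr2.
Qed.

Lemma moment_arc1 {R : realType} {J : finType} (v : J * bool) (E : {set J * bool}) :
  v \in E -> moment_arc E (moment_pos v : 'rV[R]_3).
Proof.
case: v => k e vE; pose g j := if j == k then moment_root k e : R else 0.
have gk : g k = moment_root k e by rewrite /g eqxx.
have g0 j : j != k -> g j = 0 by rewrite /g => /negPf->.
exists g; split; last first.
  move=> j gj; have [jk|/g0 gj0] := eqVneq j k; last by rewrite gj0 eqxx in gj.
  by exists e; rewrite jk // gk moment_root_sgn.
split; first by rewrite (bigD1 k) //= big1 ?gk ?addr0 // => j /g0->; rewrite scale0r.
rewrite /moment_pos dotpZl dotpZr mulrA -expr2 moment_rootE.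
by rewrite (bigD1 k) //= big1 ?gk ?addr0 // => j /g0->; rewrite mul0r.
Qed.

Lemma moment_arc_vertex {R : realType} {J : finType} (v : J * bool)
    (E : {set J * bool}) :
  (#|[set v.1 | v in E]%SET| <= 2)%N ->
  moment_arc E (moment_pos v : 'rV[R]_3) -> v \in E.
Proof.
move=> E2 vE.
have v1 : (#|[set u.1 | u in [set v]]%SET| <= 2)%N.
  by rewrite (leq_trans (leq_imset_card _ _)) // cards1.
have := moment_arc_meet _ _ _ v1 E2 (moment_arc1 v _ (finset.set11 v)) vE.
move=> /moment_arc_card1[|u]; last by rewrite !inE => /andP[/eqP-> ].
by rewrite (leq_trans (subset_leq_card (subsetIl _ _))) // cards1.
Qed.

Lemma moment_pos_inj {R : realType} {J : finType} :
  injective (@moment_pos R J).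
Proof.
move=> u v uv; apply/finset.set1P.
apply: (@moment_arc_vertex R); last by rewrite uv; apply: moment_arc1; rewrite inE.
by rewrite (leq_trans (leq_imset_card _ _)) // cards1.
Qed.

Lemma moment_arc_sub_qcircle {R : realType} {J : finType} (k l : J)
    (E : {set J * bool}) :
  k != l -> (forall v, v \in E -> v.1 \in [set k; l]%SET) ->
  (moment_arc E `<=`
    @qcircle R _ (moment_vec k) (moment_vec l) (moment_wt k) (moment_wt l))%classic.
Proof.
move=> kl Ekl x [g [[xE wE] gE]].
have g0 j : j != k -> j != l -> g j = 0.
  move=> jk jl; apply/eqP/negPn/negP => /gE[e /Ekl].
  by rewrite !inE (negPf jk) (negPf jl).
exists (g k), (g l); split.
  by rewrite xE; apply: sum_supp2 => // j jk jl; rewrite g0 ?scale0r.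
by rewrite wE; apply: sum_supp2 => // j jk jl; rewrite g0 ?mul0r.
Qed.

Lemma represents2 {R : realType} {J : finType} (k l : J) (a b : R)
    (x : 'rV[R]_3) : k != l ->
  x = a *: moment_vec k + b *: moment_vec l ->
  dotp x x - 1 = a * moment_wt k + b * moment_wt l ->
  exists g, [/\ represents g x, g k = a, g l = b &
    forall j, g j != 0 -> j = k \/ j = l].
Proof.
move=> kl xE wE; pose g j := if j == k then a else if j == l then b else 0.
have gk : g k = a by rewrite /g eqxx.
have gl : g l = b by rewrite /g eq_sym (negPf kl) eqxx.
have g0 j : j != k -> j != l -> g j = 0 by rewrite /g => /negPf-> /negPf->.
exists g; split=> //; last first.
  move=> j gj; have [->|jk] := eqVneq j k; first by left.
  have [->|jl] := eqVneq j l; first by right.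
  by rewrite g0 ?eqxx in gj.
split; rewrite (sum_supp2 k l) ?gk ?gl // => j jk jl;
  by rewrite g0 ?scale0r ?mul0r.
Qed.

Lemma indep_scale {R : realType} {d} (y z : 'rV[R]_d) (a b : R) :
  a != 0 -> b != 0 -> indep y z -> indep (a *: y) (b *: z).
Proof.
move=> a0 b0 yz s t; rewrite !scalerA => /yz[/eqP + /eqP].
by rewrite !mulf_eq0 (negPf a0) (negPf b0) !orbF => /eqP-> /eqP->.
Qed.

Lemma moment_pos_wt {R : realType} {J : finType} (v : J * bool) :
  dotp (moment_pos v) (moment_pos v) - 1 =
  moment_root v.1 v.2 * moment_wt v.1 :> R.
Proof. by rewrite -moment_rootE dotpZl dotpZr mulrA -expr2. Qed.

Lemma represents_supp2 {R : realType} {J : finType} (k l : J) g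
    (x : 'rV[R]_3) : k != l -> represents g x ->
  (forall j, g j != 0 -> j = k \/ j = l) ->
  x = g k *: moment_vec k + g l *: moment_vec l /\
  dotp x x - 1 = g k * moment_wt k + g l * moment_wt l.
Proof.
move=> kl [xE wE] gS.
have g0 j : j != k -> j != l -> g j = 0.
  by move=> jk jl; apply/eqP/negPn/negP => /gS[] je;
    rewrite je eqxx in jk jl.
split; [rewrite xE|rewrite wE];
  by apply: sum_supp2 => // j jk jl; rewrite g0 ?scale0r ?mul0r.
Qed.

(** Dividing the coordinates by the roots of the two vertices turns the sign conditions into the
    nonnegativity required in [cone_arc]. *)
Lemma moment_arc2_circular {R : realType} {J : finType} (u v : J * bool) :
  u.1 != v.1 ->
  is_circular_arc (moment_arc [set u; v]%SET) (moment_pos u) (moment_pos v : 'rV[R]_3).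
Proof.
case: u v => [k e] [l f] /= kl.
set s := @moment_root R J k e; set t := @moment_root R J l f.
have s0 : s != 0 by exact: moment_root_neq0.
have t0 : t != 0 by exact: moment_root_neq0.
have sE := @moment_root_sgn R J k e; have tE := @moment_root_sgn R J l f.
have sgnP (e' : bool) (a b : R) : 0 < sgn e' * b -> a != 0 ->
    (0 <= a / b) = (0 < sgn e' * a).
  move=> b0 a0; have b_neq0 : b != 0.
    by apply: contraTneq b0 => ->; rewrite mulr0 ltxx.
  rewrite -(pmulr_rge0 _ b0) (_ : _ * (a / b) = sgn e' * a); last by field.
  rewrite le_eqVlt; case: eqP => //= /eqP; rewrite eq_sym mulf_eq0 (negPf a0).
  by rewrite orbF /sgn; case: (e'); rewrite ?oppr_eq0 oner_eq0.
have := cone_arc (moment_pos (k, e)) (moment_pos (l, f))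
  (indep_scale _ _ _ _ s0 t0 (@indep_moment_vec R J k l kl)).
rewrite !moment_pos_wt /=; congr is_circular_arc.
apply/seteqP; split=> x /=.
  move=> [a [b [a0 b0 xE]]].
  rewrite -/s -/t (mulrA a s) (mulrA b t) => wE.
  rewrite /moment_pos !scalerA in xE.
  have [g [gx gk gl gS]] := represents2 k l _ _ x kl xE wE.
  exists g; split=> // j gj; case: (gS j gj) => je; rewrite {}je in gj *.
    exists e; first by rewrite !inE eqxx.
    by rewrite -(sgnP _ _ _ sE gj) gk mulfK.
  exists f; first by rewrite !inE eqxx orbT.
  by rewrite -(sgnP _ _ _ tE gj) gl mulfK.
move=> [g [gx gE]]; have gS j : g j != 0 -> j = k \/ j = l.
  by move=> /gE[e']; rewrite !inE => /orP[] /eqP[-> _]; [left|right].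
have [xE wE] := represents_supp2 k l g x kl gx gS.
exists (g k / s), (g l / t); split.
- have [->|gk] := eqVneq (g k) 0; first by rewrite mul0r.
  rewrite (sgnP e) //; have [e'] := gE k gk.
  by rewrite !inE => /orP[] /eqP[]; [move=> ->|move=> kl'; rewrite kl' eqxx in kl].
- have [->|gl] := eqVneq (g l) 0; first by rewrite mul0r.
  rewrite (sgnP f) //; have [e'] := gE l gl.
  by rewrite !inE => /orP[] /eqP[]; [move=> kl'; rewrite kl' eqxx in kl|move=> ->].
- by rewrite xE /moment_pos /= !scalerA !divfK.
- by rewrite wE -/s -/t (mulrA _ s) (mulrA _ t) !divfK.
Qed.

(** Both signs are allowed at [k] and only the positive one at [l]: this is the half great circle of
    [half_arc] on the side of [l]. *)
Lemma moment_arc3_circular {R : realType} {J : finType} (k l : J) : k != l ->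
  is_circular_arc (moment_arc [set (k, true); (k, false); (l, true)]%SET)
    (moment_pos (k, true)) (moment_pos (k, false) : 'rV[R]_3).
Proof.
move=> kl; set s := @moment_root R J k true.
have s0 : s != 0 by exact: moment_root_neq0.
have QE : moment_pos (k, false) =
    - (dotp (moment_pos (k, true)) (moment_pos (k, true)))^-1 *:
      moment_pos (k, true) :> 'rV[R]_3.
  rewrite /moment_pos /= scalerA; congr (_ *: _); apply/esym.
  have A0 := @moment_vec_gt0 R J k; have sE := @moment_rootE R J k true.
  have := @moment_root_sgn R J k true; rewrite dotpZl dotpZr -/s /sgn in sE *.
  rewrite mul1r => s_gt0; apply: moment_root_uniq;
    move: (dotp _ _) (moment_wt k) A0 sE => A w A0 sE.
    have -> : sgn false * (- (s * (s * A))^-1 * s) = (s * A)^-1.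
      by rewrite /sgn; field; rewrite s0 gt_eqF.
    by rewrite invr_gt0 mulr_gt0.
  have -> : w = (s ^+ 2 * A - 1) / s by rewrite sE mulrC mulKf.
  by field; rewrite s0 gt_eqF.
have Pz : indep (moment_pos (k, true)) (moment_vec l : 'rV[R]_3).
  move=> a b; rewrite /moment_pos scalerA.
  move=> /(@indep_moment_vec R J k l kl)[/eqP + ->].
  by rewrite mulf_eq0 (negPf s0) orbF => /eqP->.
have := half_arc _ _ (moment_vec l) (moment_wt l) Pz QE.
rewrite moment_pos_wt /= -/s; congr is_circular_arc.
apply/seteqP; split=> x /=; last first.
  move=> [g [gx gE]]; have gS j : g j != 0 -> j = k \/ j = l.
    by move=> /gE[e']; rewrite !inE => /orP[/orP[]|] /eqP[-> _];
      [left|left|right].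
  have [xE wE] := represents_supp2 k l g x kl gx gS.
  exists (g k / s), (g l); split.
  - have [->//|/gE[e]] := eqVneq (g l) 0.
    rewrite !inE !xpair_eqE eq_sym (negPf kl) eqxx /= => /eqP->.
    by rewrite /sgn mul1r => /ltW.
  - by rewrite xE /moment_pos /= !scalerA divfK.
  - by rewrite wE (mulrA _ s) divfK.
move=> [a [b [b0 xE]]].
rewrite (mulrA a s) => wE; rewrite /moment_pos !scalerA in xE.
have [g [gx gk gl gS]] := represents2 k l _ _ x kl xE wE.
exists g; split=> // j gj; case: (gS j gj) => je; rewrite {}je in gj *.
  have [g0|g0] := ltP 0 (g k); [exists true|exists false];
    rewrite ?inE ?eqxx ?orbT ?mul1r // /sgn mulN1r oppr_gt0.
  by rewrite lt_neqAle gj.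
exists true; first by rewrite !inE eqxx !orbT.
by rewrite /sgn mul1r lt_neqAle eq_sym gj gl.
Qed.

(** * Drawings *)

(* The two points labelled [(i, true)] and [(i, false)] are antipodal, so they
   do not determine a circle; they are joined through the auxiliary index
   [inr i]. *)
Definition hull {I : finType} (B : {set I * bool}) : {set (I + I) * bool} :=
  [set v | match v.1 with
           | inl i => (i, v.2) \in B
           | inr i => [&& v.2, (i, true) \in B & (i, false) \in B]
           end]%SET.

Lemma hull_pair {I : finType} (u v : I * bool) : u.1 != v.1 ->
  hull [set u; v]%SET = [set (inl u.1, u.2); (inl v.1, v.2)]%SET.
Proof.
case: u v => [i e] [j f] /= ij; apply/finset.setP => -[[k|k] g].
  by rewrite !inE /= !inE !xpair_eqE.
rewrite !inE /= !inE !xpair_eqE /=; case: (eqVneq k i) => [->|] //=.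
  by rewrite (negPf ij) !orbF; case: g; case: e.
by case: (k == j); case: g; case: f.
Qed.

Lemma hull_antipodal {I : finType} (i : I) :
  hull [set (i, true); (i, false)]%SET =
  [set (inl i, true); (inl i, false); (inr i, true)]%SET.
Proof.
apply/finset.setP => -[[k|k] g]; rewrite !inE /= ?inE !xpair_eqE /= ?orbF //.
by rewrite !andbF !andbT !orbF /= andbb andbC; case: g.
Qed.

Lemma cards2_label {I : finType} (B : {set I * bool}) : #|B| = 2 ->
  (exists u v, u.1 != v.1 /\ B = [set u; v]%SET) \/
  (exists i, B = [set (i, true); (i, false)]%SET).
Proof.
move=> /eqP/cards2P[[i e] [[j f] [ne ->]]].
have [ij|ij] := eqVneq i j; last by left; exists (i, e), (j, f).
right; exists i; rewrite -{}ij xpair_eqE eqxx /= in ne *.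
by case: e f ne => [] [] //= _; rewrite finset.setUC.
Qed.

Lemma hull_support {I : finType} (B : {set I * bool}) : #|B| = 2 ->
  (#|[set v.1 | v in hull B]%SET| <= 2)%N.
Proof.
move=> /cards2_label[[u [v [uv ->]]]|[i ->]].
  by rewrite (leq_trans (leq_imset_card _ _)) // hull_pair // cards2; case: eqP.
rewrite hull_antipodal !imsetU !imset_set1 /= finset.setUid cards2.
by case: eqP.
Qed.

(** An auxiliary label [inr i] occurs only in the hull of the antipodal pair [i], so distinct edges
    share no such label. *)
Lemma hull_meet {I : finType} (B B' : {set I * bool}) v :
  #|B| = 2 -> #|B'| = 2 -> B != B' -> v \in hull B -> v \in hull B' ->
  exists2 u, u \in B :&: B' & v = (inl u.1, u.2).
Proof.
move=> B2 B2' BB'; case: v => [[i|i] e]; rewrite !inE /= => vB vB'.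
  by exists (i, e); rewrite ?inE ?vB.
have pairE (E : {set I * bool}) : #|E| = 2 -> (i, true) \in E ->
    (i, false) \in E -> E = [set (i, true); (i, false)]%SET.
  move=> E2 Et Ef; apply/esym/eqP.
  by rewrite eqEcard E2 cards2 xpair_eqE andbF finset.subUset !finset.sub1set Et Ef.
case/and3P: vB vB' => _ Bt Bf /and3P[_ Bt' Bf'].
by rewrite (pairE B) // (pairE B') // eqxx in BB'.
Qed.

(** Reduces drawing to combinatorics: [K] lists index pairs, one circle each, that must cover the
    hulls of all edges. Vertices are covered separately, since an isolated vertex lies on no arc. *)
Lemma drawable_of_labels {R : realType} (G : sgraph) (I C : finType)
    (lab : G -> I * bool) (K : C -> (I + I) * (I + I)) :
  injective lab -> (forall c, (K c).1 != (K c).2) ->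
  (forall x, exists c, inl (lab x).1 \in [set (K c).1; (K c).2]%SET) ->
  (forall x y, sedge x y -> exists c,
    forall v, v \in hull [set lab x; lab y]%SET ->
      v.1 \in [set (K c).1; (K c).2]%SET) ->
  drawable_on_spheres R 3 G 1 #|C|.
Proof.
move=> lab_inj K_neq K_vtx K_edge.
pose pos x : 'rV[R]_3 := moment_pos (inl (lab x).1 : I + I, (lab x).2).
pose arc (A : {set G}) : set 'rV[R]_3 := moment_arc (hull (lab @: A)%SET).
pose S (i : 'I_#|C|) := let k := K (enum_val i) in
  @qcircle R _ (moment_vec k.1) (moment_vec k.2) (moment_wt k.1) (moment_wt k.2).
have vtx_inj : injective (fun x => (inl (lab x).1 : I + I, (lab x).2)).
  by move=> x y [h1 h2]; apply: lab_inj; apply/eqP; rewrite -pair_eqE /= h1 h2 !eqxx.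
have edgeP (A : {set G}) : A \in edges G ->
    exists x y, sedge x y /\ A = [set x; y]%SET.
  by rewrite inE => /existsP[x /existsP[y /andP[xy /eqP->]]]; exists x, y.
have edge_neq (x y : G) : sedge x y -> x != y.
  by apply: contraTneq => ->; rewrite sedge_irr.
have card_edge (A : {set G}) : A \in edges G -> #|(lab @: A)%SET| = 2.
  by move=> /edgeP[x [y [/edge_neq xy ->]]]; rewrite card_imset // cards2 xy.
exists pos, arc, S; split.
- split; first by move=> x y /moment_pos_inj/vtx_inj.
  move=> x y xy; rewrite /arc imsetU1 imset_set1.
  have [ij|ij] := eqVneq (lab x).1 (lab y).1; last first.
    by rewrite hull_pair //; exact: moment_arc2_circular.
  have e_neq : (lab x).2 != (lab y).2.
    apply: contraNneq (edge_neq _ _ xy) => ef; apply/eqP/lab_inj/eqP.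
    by rewrite -pair_eqE /= ij ef !eqxx.
  rewrite /pos; move: ij e_neq; case: (lab x) (lab y) => [i e] [j f] /= <-.
  have H := @moment_arc3_circular R _ (inl i : I + I) (inr i : I + I) isT.
  case: e f => [] [] //= _; first by rewrite hull_antipodal.
  by rewrite finset.setUC hull_antipodal; exact: circular_arc_sym.
- split.
    move=> A x /card_edge A2 /(moment_arc_vertex _ _ (hull_support _ A2)).
    by rewrite inE /= -surjective_pairing mem_imset.
  move=> A B z /card_edge A2 /card_edge B2 AB zA zB.
  have labAB : (lab @: A)%SET != (lab @: B)%SET by rewrite (inj_eq (imset_inj lab_inj)).
  have zAB := moment_arc_meet _ _ _ (hull_support _ A2) (hull_support _ B2) zA zB.
  have [|v] := moment_arc_card1 _ _ _ zAB.
    (* Two distinct two-element label sets share at most one label, hence so do their hulls. *)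
    apply/card_le1_eqP => v w; rewrite !finset.in_setI => /andP[vA vB] /andP[wA wB].
    have [u uAB ->] := hull_meet _ _ _ A2 B2 labAB vA vB.
    have [u' uAB' ->] := hull_meet _ _ _ A2 B2 labAB wA wB.
    suff /card_le1_eqP/(_ _ _ uAB uAB')-> :
      (#|(lab @: A)%SET :&: (lab @: B)%SET|%SET <= 1)%N by [].
    rewrite leqNgt; apply: contra labAB => AB2.
    have AE : ((lab @: A) :&: (lab @: B) == (lab @: A))%SET.
      by rewrite eqEcard finset.subsetIl A2.
    by rewrite eqEcard -{1}(eqP AE) finset.subsetIr A2 B2.
  rewrite finset.in_setI => /andP[vA vB] zv.
  have [u] := hull_meet _ _ _ A2 B2 labAB vA vB.
  rewrite inE => /andP[/imsetP[x xA ux]]; rewrite ux mem_imset // => xB vE.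
  by exists x; rewrite ?inE ?xA // zv vE.
- by move=> i; apply: is_sphere_qcircle; exact: indep_moment_vec.
- move=> z [[x _ <-]|[A Aedge zA]].
    have [c xc] := K_vtx x; exists (enum_rank c) => //; rewrite /S /= enum_rankK.
    apply: (moment_arc_sub_qcircle _ _ [set (inl (lab x).1, (lab x).2)]%SET) => //.
      by move=> v; rewrite inE => /eqP->.
    by apply: moment_arc1; rewrite inE.
  have [x [y [xy AE]]] := edgeP A Aedge.
  have [c cP] := K_edge x y xy; exists (enum_rank c) => //; rewrite /S /= enum_rankK.
  apply: (moment_arc_sub_qcircle _ _ (hull (lab @: A)%SET)) => // v.
  by rewrite AE imsetU1 imset_set1; exact: cP.
Qed.

(** * Pairing the vertices: upper bounds *)

Lemma half_lt_uphalf n (k : 'I_n) : (k./2 < uphalf n)%N.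
Proof. by have := ltn_ord k; lia. Qed.

(** Vertices [2 * i] and [2 * i + 1] form the antipodal pair [i]; for odd [n] the last pair has a
    single vertex. *)
Definition halve {n : nat} (k : 'I_n) : 'I_(uphalf n) * bool :=
  (Ordinal (half_lt_uphalf n k), odd k).

Lemma halve_inj n : injective (@halve n).
Proof.
by move=> k l [hk ok]; apply: val_inj; rewrite /= -(odd_double_half k) hk ok
  odd_double_half.
Qed.

(** [C] enumerates the index pairs [i <= j]. For [i < j] the circle carries the edges between pairs
    [i] and [j]; for [i = j] it passes through the auxiliary direction and carries the edge inside
    the pair. *)
Lemma complete_graph_upper {R : realType} n :
  drawable_on_spheres R 3 (complete_graph n) 1 (\sum_(j < uphalf n) j.+1)%N.
Proof.
pose C := {j : 'I_(uphalf n) & 'I_j.+1}.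
have -> : (\sum_(j < uphalf n) j.+1)%N = #|{: C}|.
  rewrite card_tagged sumnE big_map big_enum /=.
  by apply: eq_bigr => j _; rewrite card_ord.
pose fst_ (c : C) := widen_ord (ltn_ord (tag c)) (tagged c).
pose K (c : C) : ('I_(uphalf n) + 'I_(uphalf n)) * ('I_(uphalf n) + 'I_(uphalf n)) :=
  if fst_ c == tag c then (inl (tag c), inr (tag c))
  else (inl (fst_ c), inl (tag c)).
have pairC (i j : 'I_(uphalf n)) : (i <= j)%N ->
    exists c : C, fst_ c = i /\ tag c = j.
  move=> ij; exists (Tagged (fun j : 'I_(uphalf n) => 'I_j.+1)
    (Ordinal (ij : (i < j.+1)%N))).
  by split=> //; apply: val_inj.
apply: (@drawable_of_labels R (complete_graph n) _ C (@halve n) K).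
- exact: halve_inj.
- by move=> c; rewrite /K; case: (eqVneq (fst_ c) (tag c)).
- move=> x; have [c [ci cj]] := pairC _ _ (leqnn (halve x).1).
  by exists c; rewrite /K ci cj eqxx !inE eqxx.
move=> x y xy; wlog le_xy : x y xy / ((halve x).1 <= (halve y).1)%N.
  move=> H; have [/H|/ltnW/H] := leqP (halve x).1 (halve y).1; first exact.
  by rewrite finset.setUC; apply; rewrite sedge_sym.
have [c [ci cj]] := pairC _ _ le_xy; exists c; rewrite /K ci cj.
have [ij|ij] := eqVneq (halve x).1 (halve y).1.
  have idx k e : (k, e) \in [set halve x; halve y]%SET -> k = (halve y).1.
    by rewrite !inE => /orP[] /eqP/(congr1 fst)/= ->.
  by case=> -[k|k] e; rewrite inE /=; [move=> /idx->|move=> /and3P[_ /idx-> _]];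
    rewrite !inE eqxx ?orbT.
by move=> v; rewrite hull_pair // !inE => /orP[] /eqP-> /=; rewrite eqxx ?orbT.
Qed.

(** Each part is paired separately, so no edge joins antipodal points, and one circle per choice of
    a pair from each part suffices. *)
Lemma complete_bipartite_upper {R : realType} p q : (0 < p)%N -> (0 < q)%N ->
  drawable_on_spheres R 3 (complete_bipartite_graph p q) 1
    (uphalf p * uphalf q)%N.
Proof.
move=> p0 q0; pose I := ('I_(uphalf p) + 'I_(uphalf q))%type.
pose C := ('I_(uphalf p) * 'I_(uphalf q))%type.
have -> : (uphalf p * uphalf q)%N = #|{: C}| by rewrite card_prod !card_ord.
pose lab (x : 'I_p + 'I_q) : I * bool := match x with
  | inl k => (inl (halve k).1, (halve k).2)
  | inr k => (inr (halve k).1, (halve k).2)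
  end.
pose K (c : C) : (I + I) * (I + I) := (inl (inl c.1), inl (inr c.2)).
have edgeC k l : exists c, forall v, v \in hull [set lab (inl k); lab (inr l)]%SET ->
    v.1 \in [set (K c).1; (K c).2]%SET.
  exists ((halve k).1, (halve l).1) => v; rewrite hull_pair // !inE.
  by case/orP=> /eqP-> /=; rewrite eqxx ?orbT.
apply: (@drawable_of_labels R (complete_bipartite_graph p q) I C lab K).
- by move=> [k|k] [l|l] //= [h o]; congr (_ _); apply: halve_inj;
    apply/eqP; rewrite -pair_eqE /=; apply/andP; split; apply/eqP => //;
    apply: val_inj.
- by [].
- case=> k; [exists ((halve k).1, (halve (Ordinal q0)).1)|
             exists ((halve (Ordinal p0)).1, (halve k).1)];
    by rewrite !inE eqxx ?orbT.
by case=> k [] l // _; rewrite finset.setUC; exact: edgeC.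
Qed.

(** * Bounds on the cover numbers *)

Lemma cover_number_exists {R : realType} l d (G : sgraph) s0 :
  drawable_on_spheres R d G l s0 ->
  exists2 s, is_spherical_cover_number R l d G s & (s <= s0)%N.
Proof.
move=> /asboolP h; have ex : exists s, `[< drawable_on_spheres R d G l s >] by exists s0.
case: (ex_minnP ex) => s /asboolP hs smin; exists s; last exact: smin.
by split=> // s' /asboolP; exact: smin.
Qed.

Lemma double_sum_succ m : (2 * \sum_(j < m) j.+1 = m * m.+1)%N.
Proof.
elim: m => [|m IH]; first by rewrite big_ord0.
by rewrite big_ord_recr mulnDr IH /=; lia.
Qed.

Lemma uphalf_le_ceil {R : realType} n : (uphalf n)%:Z <= Num.ceil (n%:R / 2 : R).
Proof.
rewrite -ltzD1 -(ltr_int R) rmorphD /=.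
have := ceil_ge (n%:R / 2 : R).
have : (2 * uphalf n)%N%:R <= (n + 1)%N%:R :> R by rewrite ler_nat; lia.
rewrite natrM natrD -pmulrn => h1 h2.
suff : (uphalf n)%:R < (Num.ceil (n%:R / 2 : R))%:~R + 1 :> R by [].
by lra.
Qed.

Theorem theorem2 (R : realType) (n p q : nat)
    (hn : (0 < n)%N) (hp : (0 < p)%N) (hq : (0 < q)%N) :
  (exists s : nat,
     [/\ is_spherical_cover_number R 1 3 (complete_graph n) s,
         Num.floor (n%:R ^+ 2 / 8 : R) <= s%:Z &
         s%:R <= (n%:R ^+ 2 + 5 * n%:R + 6) / 6 :> R])
  /\
  (exists s : nat,
     [/\ is_spherical_cover_number R 1 3 (complete_bipartite_graph p q) s,
         Num.ceil (p%:R * q%:R / 4 : R) <= s%:Z &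
         s%:Z <= Num.ceil (p%:R / 2 : R) * Num.ceil (q%:R / 2 : R)]).
Proof.
split.
  have [s sP s_le] := cover_number_exists _ _ _ _ (@complete_graph_upper R n).
  exists s; split=> //.
    (* [n^2 <= 8 * s + 1] gives [n^2 / 8 < s + 1], so the floor is at most [s]. *)
    have := complete_graph_lower n s hn sP.1; rewrite -(ler_nat R).
    rewrite natrX natrD natrM => h.
    rewrite -ltzD1 -(ltr_int R) rmorphD /=.
    apply: le_lt_trans (floor_le _) _.
    suff : (n%:R ^+ 2 / 8 : R) < s%:R + 1 by [].
    by lra.
  have sumE := double_sum_succ (uphalf n).
  (* With [m = uphalf n], [s <= m (m + 1) / 2 <= (n + 1) (n + 3) / 8 <= (n + 2) (n + 3) / 6]. *)
  have : (6 * s <= n ^ 2 + 5 * n + 6)%N.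
    have : (2 * s <= uphalf n * (uphalf n).+1)%N by rewrite -sumE leq_mul2l.
    have : (2 * uphalf n <= n + 1)%N by lia.
    move: (uphalf n) => m; nia.
  by rewrite -(ler_nat R) natrM 2!natrD natrX natrM; lra.
have [s sP s_le] := cover_number_exists _ _ _ _ (@complete_bipartite_upper R p q hp hq).
exists s; split=> //.
  rewrite ceil_le_int.
  have := complete_bipartite_lower p q s hp hq sP.1; rewrite -(ler_nat R) !natrM.
  move=> h; suff : (p%:R * q%:R / 4 : R) <= s%:R by [].
  by lra.
apply: (@le_trans _ _ ((uphalf p)%:Z * (uphalf q)%:Z)).
  by rewrite -PoszM lez_nat.
by apply: ler_pM => //; exact: uphalf_le_ceil.
Qed.
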